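(* Let $p\ge 5$ be a prime. For every integer $j$ with $0<j<p$, $$\sum_{k=0}^{p-1}T(k,j)\equiv \frac{(-1)^j+1}{2}\cdot(-1)^{\frac{p-j-1}{2}}\pmod{p}$$ (so the right-hand side is $0$ when $j$ is odd and $(-1)^{(p-j-1)/2}$ when $j$ is even). Moreover, $$\sum_{m=0}^{p-1}\sum_{n=0}^{p-1}T(m,n)\equiv \frac{1}{2}\left((-1)^{\frac{p-1}{2}}+1\right)\pmod{p}.$$
   Context: For an integer $n\ge 0$ and an integer $j$, the trinomial coefficient $T(n,j)$ is the coefficient of $x^j$ in the Laurent polynomial $(1+x+x^{-1})^n$, i.e. $(1+x+x^{-1})^n=\sum_{j=-n}^{n}T(n,j)x^j$ (and $T(n,j)=0$ for $|j|>n$). Congruences between rationals are understood in the ring of rationals with denominators prime to $p$. *)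

(* Defs.v *)
From HB Require Import structures.
From mathcomp Require Import all_boot all_order all_algebra.
From mathcomp Require Import finmap.
From mathcomp Require Import monalg.

Set Implicit Arguments.
Unset Strict Implicit.
Unset Printing Implicit Defensive.

Import GRing.Theory Num.Theory.

Local Open Scope ring_scope.

(* The ring R[x, x^-1] of Laurent polynomials: finitely supported functions
   int -> R.  monalg.v puts a ring structure on {malg R[K]} only when
   a * b = 1 implies a = b = 1 in the exponent monoid K, which excludes the
   additive group of int; hence this alias of the additive group {malg R[int]},
   with its own convolution product. *)
Definition laurent (R : nzRingType) := {malg R[int]}.

HB.instance Definition _ (R : nzRingType) := GRing.Zmodule.on (laurent R).

Definition laurent_coef (R : nzRingType) (f : laurent R) (j : int) : R :=
  mcoeff j f.

Section LaurentRing.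
Variable R : nzRingType.
Implicit Types (f g h : laurent R) (a b : int) (c : R) (d : {fset int}).

Definition lmon c a : laurent R := << c *g a >>.

Definition lmul f g : laurent R :=
  \sum_(a <- msupp f) \sum_(b <- msupp g)
    lmon (laurent_coef f a * laurent_coef g b) (a + b).

Lemma lmon0 a : lmon 0 a = 0.
Proof. exact: monalgU0. Qed.

Lemma lmonD a c1 c2 : lmon (c1 + c2) a = lmon c1 a + lmon c2 a.
Proof. exact: monalgUD. Qed.

Lemma laurent_coefD f g a :
  laurent_coef (f + g) a = laurent_coef f a + laurent_coef g a.
Proof. exact: mcoeffD. Qed.

Lemma laurent_coef_mon c a b : laurent_coef (lmon c a) b = c *+ (a == b).
Proof. exact: mcoeffU. Qed.

Lemma laurent_eqP f g :
  (forall a, laurent_coef f a = laurent_coef g a) <-> f = g.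
Proof. exact: malgP. Qed.

Lemma lmulEw d1 d2 f g :
    (msupp f `<=` d1)%fset -> (msupp g `<=` d2)%fset ->
  lmul f g = \sum_(a <- d1) \sum_(b <- d2)
    lmon (laurent_coef f a * laurent_coef g b) (a + b).
Proof.
move=> le1 le2; rewrite /lmul (big_fset_incl _ le1) /=.
  apply/eq_bigr => a _; apply/big_fset_incl => // k _ /mcoeff_outdom gk.
  by rewrite /laurent_coef gk mulr0 lmon0.
move=> k _ /mcoeff_outdom fk; rewrite big1 // => k' _.
by rewrite /laurent_coef fk mul0r lmon0.
Qed.

Lemma lmulDl : left_distributive lmul +%R.
Proof.
move=> f g h.
rewrite (lmulEw (msuppD_le f g) (fsubset_refl (msupp h))).
rewrite (lmulEw (fsubsetUl _ (msupp g)) (fsubset_refl (msupp h))).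
rewrite (lmulEw (fsubsetUr (msupp f) _) (fsubset_refl (msupp h))).
rewrite -big_split; apply/eq_bigr => a _; rewrite -big_split.
by apply/eq_bigr => b _; rewrite laurent_coefD mulrDl lmonD.
Qed.

Lemma lmulDr : right_distributive lmul +%R.
Proof.
move=> h f g.
rewrite (lmulEw (fsubset_refl (msupp h)) (msuppD_le f g)).
rewrite (lmulEw (fsubset_refl (msupp h)) (fsubsetUl _ (msupp g))).
rewrite (lmulEw (fsubset_refl (msupp h)) (fsubsetUr (msupp f) _)).
rewrite -big_split; apply/eq_bigr => a _; rewrite -big_split.
by apply/eq_bigr => b _; rewrite laurent_coefD mulrDr lmonD.
Qed.

Lemma lmul0l : left_zero 0 lmul.
Proof. by move=> f; rewrite /lmul msupp0 big_seq_fset0. Qed.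

Lemma lmul0r : right_zero 0 lmul.
Proof.
by move=> f; rewrite /lmul big1 // => a _; rewrite msupp0 big_seq_fset0.
Qed.

Lemma lmul_mon c1 c2 a b : lmul (lmon c1 a) (lmon c2 b) = lmon (c1 * c2) (a + b).
Proof.
rewrite (lmulEw msuppU_le msuppU_le) !big_seq_fset1.
by rewrite !laurent_coef_mon !eqxx !mulr1n.
Qed.

Lemma laurentE f : f = \sum_(a <- msupp f) lmon (laurent_coef f a) a.
Proof. exact: monalgE. Qed.

Lemma lmul_suml (I : Type) (r : seq I) (F : I -> laurent R) g :
  lmul (\sum_(i <- r) F i) g = \sum_(i <- r) lmul (F i) g.
Proof.
exact: (big_morph (lmul^~ g) (fun _ _ => lmulDl _ _ _) (lmul0l _)).
Qed.

Lemma lmul_sumr (I : Type) (r : seq I) (F : I -> laurent R) f :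
  lmul f (\sum_(i <- r) F i) = \sum_(i <- r) lmul f (F i).
Proof.
exact: (big_morph (lmul f) (fun _ _ => lmulDr _ _ _) (lmul0r _)).
Qed.

Lemma lmulA : associative lmul.
Proof.
move=> f g h; rewrite (laurentE f) !lmul_suml; apply/eq_bigr => a _.
rewrite (laurentE g) !(lmul_suml, lmul_sumr); apply/eq_bigr => b _.
rewrite (laurentE h) !lmul_sumr; apply/eq_bigr => k _.
by rewrite !lmul_mon mulrA addrA.
Qed.

Lemma lmul1l : left_id (lmon 1 0) lmul.
Proof.
move=> f; rewrite {1}(laurentE f) lmul_sumr [RHS]laurentE.
by apply/eq_bigr => a _; rewrite lmul_mon mul1r add0r.
Qed.

Lemma lmul1r : right_id (lmon 1 0) lmul.
Proof.
move=> f; rewrite {1}(laurentE f) lmul_suml [RHS]laurentE.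
by apply/eq_bigr => a _; rewrite lmul_mon mulr1 addr0.
Qed.

Lemma lone_neq0 : lmon 1 0 != 0.
Proof.
apply/eqP => /laurent_eqP/(_ 0); rewrite laurent_coef_mon eqxx mulr1n.
by rewrite /laurent_coef mcoeff0 => /eqP; rewrite oner_eq0.
Qed.

HB.instance Definition _ := GRing.Zmodule_isNzRing.Build (laurent R)
  lmulA lmul1l lmul1r lmulDl lmulDr lone_neq0.

End LaurentRing.

Arguments lmon {R} c a.

(* The monomial x^a. *)
Definition lX {R : nzRingType} (a : int) : laurent R := lmon 1 a.

Lemma lX0 (R : nzRingType) : lX 0 = 1 :> laurent R.
Proof. by []. Qed.

Lemma lXD (R : nzRingType) (a b : int) : lX (a + b) = lX a * lX b :> laurent R.
Proof. by rewrite [RHS]lmul_mon mulr1. Qed.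

Definition trinomial (n : nat) (j : int) : int :=
  laurent_coef ((1 + lX 1 + lX (- 1)) ^+ n : laurent int) j.

Lemma trinomial0 (j : int) : trinomial 0 j = (j == 0)%:R.
Proof. by rewrite /trinomial expr0 laurent_coef_mon eq_sym. Qed.

Lemma laurent_coef_lXM (R : nzRingType) (a j : int) (f : laurent R) :
  laurent_coef (lX a * f) j = laurent_coef f (j - a).
Proof.
rewrite {1}(laurentE f) mulr_sumr [in RHS](laurentE f) /laurent_coef !raddf_sum.
apply/eq_bigr => b _; rewrite [lX a * _]lmul_mon mul1r.
rewrite [LHS]laurent_coef_mon [RHS]laurent_coef_mon.
by rewrite addrC [in RHS]eq_sym subr_eq eq_sym.
Qed.

Lemma trinomialS (n : nat) (j : int) :
  trinomial n.+1 j = trinomial n (j - 1) + trinomial n j + trinomial n (j + 1).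
Proof.
rewrite /trinomial exprS !mulrDl mul1r !laurent_coefD !laurent_coef_lXM opprK.
by rewrite [X in X + _]addrC.
Qed.

(* Z_(p), and congruence modulo its ideal p Z_(p). *)
Definition p_integral (p : nat) (x : rat) : bool := coprime p `|denq x|%N.

Definition rat_congr (p : nat) (x y : rat) : Prop :=
  [/\ p_integral p x, p_integral p y
    & exists2 z : rat, p_integral p z & x - y = p%:R * z].

(* Main.v *)
(** Modulo [p] one has [(1 + x + x^-1)^p = 1 + x^p + x^-p].  Summing the
    three-term recurrence of the trinomial coefficients over [k < p] telescopes
    to [S (j - 1) + S (j + 1) = T(p, j) - T(0, j)], where
    [S j = \sum_(k < p) T(k, j)]; modulo [p] the right-hand side vanishes for
    [0 <= j < p].  Descending from [S p = 0] and [S (p - 1) = 1] in steps of two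
    determines every [S j], and the double sum is then an alternating sum of
    signs. *)
Require Import Defs.
From mathcomp Require Import all_boot all_order all_algebra.
From mathcomp Require Import monalg zify ring.

Import GRing.Theory Num.Theory.
Local Open Scope ring_scope.

Lemma trinomial_gt (n : nat) (j : int) : n%:Z < j -> trinomial n j = 0.
Proof.
elim: n j => [|n IHn] j lt_nj; first by rewrite trinomial0; case: eqP => //; lia.
by rewrite trinomialS !IHn; lia.
Qed.

Lemma trinomial_diag (n : nat) : trinomial n n%:Z = 1.
Proof.
elim: n => [|n IHn]; first by rewrite trinomial0.
rewrite trinomialS (_ : n.+1%:Z - 1 = n%:Z); last by lia.
by rewrite IHn !trinomial_gt //; lia.
Qed.

(** The coefficients over [R] obey the same three-term recurrence. This carries T(p, j) into a ring
    of characteristic p, where the Frobenius map applies. *)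
Lemma trinomial_laurent (R : nzRingType) (n : nat) (j : int) :
  (trinomial n j)%:~R
    = laurent_coef ((1 + lX 1 + lX (- 1)) ^+ n : laurent R) j.
Proof.
elim: n j => [|n IHn] j.
  by rewrite trinomial0 expr0 laurent_coef_mon eq_sym; case: eqP.
rewrite trinomialS !rmorphD /= !IHn exprS !mulrDl mul1r.
rewrite !laurent_coefD !laurent_coef_lXM opprK.
by rewrite [X in X + _]addrC.
Qed.

Lemma lX_exp (R : nzRingType) (a : int) (n : nat) :
  lX a ^+ n = lX (a *+ n) :> laurent R.
Proof.
by elim: n => [|n IHn]; rewrite ?mulr0n ?lX0 // exprS IHn -lXD mulrS.
Qed.

Lemma pchar_laurent (R : nzRingType) (p : nat) :
  p \in [pchar R] -> p \in [pchar (laurent R)].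
Proof.
case/andP=> p_pr /eqP p0; apply/andP; split=> //; apply/eqP/laurent_eqP => a.
rewrite /laurent_coef mcoeffMn mcoeff0 [mcoeff _ _]laurent_coef_mon.
by rewrite mulrnAC p0 mul0rn.
Qed.

Lemma trinomial_pchar (R : nzRingType) (p : nat) (j : int) :
    p \in [pchar R] ->
  (trinomial p j)%:~R = (j == 0)%:R + (j == p%:Z)%:R + (j == - p%:Z)%:R :> R.
Proof.
move=> pR; have pL := pchar_laurent _ _ pR; rewrite trinomial_laurent.
(* [R] may be noncommutative, and Frobenius is additive only on commuting elements; 1 and the powers
   of x do commute. *)
have c1 (f : laurent R) : GRing.comm 1 f by rewrite /GRing.comm mul1r mulr1.
have cX a b : GRing.comm (lX a : laurent R) (lX b).
  by rewrite /GRing.comm -!lXD addrC.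
rewrite -(pFrobenius_autE pL) pFrobenius_autD_comm; last first.
  by apply/commr_sym/commrD; [exact/commr_sym/c1 | exact: cX].
rewrite pFrobenius_autD_comm // pFrobenius_aut1 !pFrobenius_autE !lX_exp.
rewrite !laurent_coefD !laurent_coef_mon mulNrn natz.
by rewrite [0 == j]eq_sym [p%:Z == j]eq_sym [- p%:Z == j]eq_sym.
Qed.

Definition trinomial_sum (p : nat) (j : int) : int :=
  \sum_(0 <= k < p) trinomial k j.

Lemma trinomial_sum_step (p : nat) (j : int) :
  trinomial_sum p (j - 1) + trinomial_sum p (j + 1)
    = trinomial p j - trinomial 0 j.
Proof.
rewrite -(telescope_sumr (trinomial^~ j) (leq0n p)) -big_split /=.
by apply: eq_bigr => k _; rewrite trinomialS; ring.
Qed.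

Lemma trinomial_sum_ge (p : nat) (j : int) :
  p%:Z <= j -> trinomial_sum p j = 0.
Proof.
move=> le_pj; rewrite /trinomial_sum big_nat; apply: big1 => k lt_kp.
by rewrite trinomial_gt //; lia.
Qed.

Lemma trinomial_sum_diag (n : nat) : trinomial_sum n.+1 n%:Z = 1.
Proof.
rewrite /trinomial_sum big_nat_recr //= -/(trinomial_sum _ _).
by rewrite trinomial_sum_ge // add0r trinomial_diag.
Qed.

Lemma trinomial_sum_pchar (R : nzRingType) (p i : nat) :
    p \in [pchar R] -> (i <= p)%N ->
  (trinomial_sum p (p%:Z - i%:Z))%:~R
    = (if odd i then (-1) ^+ i./2 else 0)%:~R :> R.
Proof.
move=> pR; have p_gt0 : (0 < p)%N by case/andP: pR => /prime_gt0.
elim/ltn_ind: i => -[|[|i]] IHi le_ip.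
- by rewrite subr0 trinomial_sum_ge.
- rewrite (_ : p%:Z - 1%:Z = p.-1%:Z); last by lia.
  by rewrite -[in trinomial_sum p](prednK p_gt0) trinomial_sum_diag.
(* The index j = p - (i + 1) satisfies 0 < j < p, so the terms at p and -p vanish, and the term at 0
   cancels against T(0, j). What remains is S (j - 1) = - S (j + 1). *)
have := congr1 (fun m : int => m%:~R : R) (trinomial_sum_step p (p%:Z - i.+1%:Z)).
rewrite rmorphB rmorphD /= trinomial_pchar // trinomial0.
rewrite (_ : (_ == p%:Z) = false); last by apply/eqP; lia.
rewrite (_ : (_ == - p%:Z) = false); last by apply/eqP; lia.
rewrite !addr0 rmorph_nat subrr.
rewrite (_ : p%:Z - i.+1%:Z - 1 = p%:Z - i.+2%:Z); last by lia.
rewrite (_ : p%:Z - i.+1%:Z + 1 = p%:Z - i%:Z); last by lia.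
rewrite (IHi i) ?(ltnW (ltnW le_ip)) //.
move/eqP; rewrite addr_eq0 => /eqP ->; rewrite -rmorphN /= negbK.
by case: odd; rewrite ?oppr0 // exprS mulN1r.
Qed.

Lemma rat_congr_int (p : nat) (a b : int) :
  prime p -> (a%:~R = b%:~R :> 'F_p) -> rat_congr p a%:~R b%:~R.
Proof.
move=> p_pr eq_ab; have int_p (c : int) : p_integral p c%:~R.
  by rewrite /p_integral denq_int coprimen1.
split=> //; have: (a - b)%:~R == 0 :> 'F_p by rewrite rmorphB /= eq_ab subrr.
rewrite -(dvdz_pcharf (pchar_Fp p_pr)) => /dvdzP[c def_c].
by exists c%:~R => //; rewrite -rmorphB /= def_c rmorphM /= mulrC.
Qed.

(** Only odd n + 1 contribute, giving N + 1 alternating signs that start with 1. *)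
Lemma sum_alternating (N : nat) :
  \sum_(0 <= n < N.*2.+1) (if odd n.+1 then (-1) ^+ n.+1./2 else 0 : int)
    = (~~ odd N)%:R.
Proof.
elim: N => [|N IHN]; first by rewrite big_nat1.
rewrite doubleS 2?big_nat_recr //= IHN !odd_double /= addr0.
by rewrite uphalf_double exprS -signr_odd; case: odd.
Qed.

Theorem theorem3 (p : nat) (p_prime : prime p) (p_ge5 : (5 <= p)%N) :
  (forall j : nat, (0 < j < p)%N ->
     rat_congr p
       (\sum_(0 <= k < p) (trinomial k j%:Z)%:~R)
       (((-1) ^+ j + 1) / 2 * (-1) ^+ ((p - j - 1) %/ 2)))
  /\ rat_congr p
       (\sum_(0 <= m < p) \sum_(0 <= n < p) (trinomial m n%:Z)%:~R)
       (1 / 2 * ((-1) ^+ ((p - 1) %/ 2) + 1)).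
Proof.
have p_odd : odd p by case: (even_prime p_prime) => // p2; rewrite p2 in p_ge5.
have pFp := pchar_Fp p_prime.
have half_sign n : ((-1) ^+ n + 1) / 2 = (~~ odd n)%:R :> rat.
  by rewrite -signr_odd; case: odd.
split=> [j /andP[_ lt_jp]|].
  rewrite half_sign -(rmorph_sum (intmul 1)) /= -/(trinomial_sum p j%:Z).
  (* For odd [j] the division by 2 truncates, but the first factor is 0; for even [j], p - j is odd
     and the exponent equals [(p - j)./2]. *)
  rewrite (_ : _ * _ =
    (if odd (p - j) then (-1) ^+ (p - j)./2 else 0 : int)%:~R); last first.
    rewrite oddB ?p_odd 1?ltnW //=; case: (boolP (odd j)) => odd_j /=.
      by rewrite mul0r.
    rewrite mul1r rmorphXn /= rmorphN1; congr (_ ^+ _).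
    have: odd (p - j) by rewrite oddB ?p_odd 1?ltnW //= odd_j.
    lia.
  apply: rat_congr_int => //; rewrite -(trinomial_sum_pchar _ _ _ pFp) ?leq_subr //.
  by congr (trinomial_sum p _)%:~R; lia.
(* Summing over [m] first turns the inner sum into S n. *)
rewrite [1 / 2 * _]mulrC mul1r half_sign exchange_big /=.
rewrite (eq_bigr (fun n : nat => (trinomial_sum p n%:Z)%:~R)); last first.
  by move=> n _; rewrite /trinomial_sum rmorph_sum.
rewrite -(rmorph_sum (intmul 1)) /= pmulrn.
(* Reversing the range replaces S n by S (p - (n + 1)), whose residue is known; then p = 2N + 1 with
   N = [p./2]. *)
apply: rat_congr_int => //; rewrite big_nat_rev /= add0n rmorph_sum /=.
rewrite (_ : (p - 1) %/ 2 = p./2)%N; last by lia.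
rewrite -natz -sum_alternating.
rewrite (_ : p./2.*2.+1 = p); last by lia.
rewrite rmorph_sum /= !big_nat; apply: eq_bigr => n lt_np.
transitivity ((trinomial_sum p (p%:Z - n.+1%:Z))%:~R : 'F_p); last first.
  exact: trinomial_sum_pchar.
by congr (trinomial_sum p _)%:~R; lia.
Qed.
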